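(* Let $u$ be a Sturmian word over a two-letter alphabet $\mathcal{A}$. Then $u$ is strongly modulo-recurrent.
   Context: For a finite alphabet $\mathcal{A}$, $\mathcal{A}^*$ is the free monoid of finite words over $\mathcal{A}$ and $|v|$ is the length of $v\in\mathcal{A}^*$. An infinite word is a sequence $u=u_0u_1u_2\cdots$ of letters indexed by $\mathbb{N}=\{0,1,2,\dots\}$. A factor of $u$ of length $n$ is a word $u_ku_{k+1}\cdots u_{k+n-1}$ with $k\ge 0$; it is said to appear at position $k$. The complexity $P_u(n)$ is the number of distinct factors of $u$ of length $n$. An infinite word $u$ is Sturmian if $P_u(n)=n+1$ for every $n\ge 0$ (so $u$ uses exactly two letters). An infinite word $u$ is modulo-recurrent if for every factor $w$ of $u$, every $k\ge 1$ and every $i\in\{0,1,\dots,k-1\}$ there is $l\in\mathbb{N}$ such that $w=u_{kl+i}u_{kl+i+1}\cdots u_{kl+i+|w|-1}$ (that is, $w$ appears in $u$ at some position congruent to $i$ modulo $k$). An infinite word $u$ over $\mathcal{A}$ is strongly modulo-recurrent if, for every monoid morphism $\sigma:\mathcal{A}^*\to\mathcal{A}^*$ such that $\gcd(|\sigma(a)|,|\sigma(b)|)=1$ for all $a,b\in\mathcal{A}$ with $a\ne b$, the word $\sigma(u)=\sigma(u_0)\sigma(u_1)\sigma(u_2)\cdots$ is modulo-recurrent. *)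

(* Defs.v *)
From mathcomp Require Import all_boot.
From mathcomp Require Import boolp.

Set Implicit Arguments.
Unset Strict Implicit.
Unset Printing Implicit Defensive.

Definition infword (A : Type) := nat -> A.

(* The block u_k u_(k+1) ... u_(k+n-1). *)
Definition block (A : Type) (u : infword A) (k n : nat) : seq A :=
  [seq u j | j <- iota k n].

Definition appears_at (A : Type) (w : seq A) (u : infword A) (k : nat) : Prop :=
  w = block u k (size w).

Definition factor (A : Type) (u : infword A) (w : seq A) : Prop :=
  exists k : nat, appears_at w u k.

Definition complexity (A : finType) (u : infword A) (n : nat) : nat :=
  #|[set w : n.-tuple A | `[< factor u w >]]|.

Definition sturmian (A : finType) (u : infword A) : Prop :=
  forall n : nat, complexity u n = n.+1.

Definition modulo_recurrent (A : Type) (u : infword A) : Prop :=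
  forall w : seq A, factor u w ->
  forall k : nat, 1 <= k -> forall i : nat, i < k ->
  exists l : nat, appears_at w u (k * l + i).

Definition word_morphism (A B : Type) (sigma : seq A -> seq B) : Prop :=
  sigma [::] = [::] /\ {morph sigma : s t / s ++ t}.

(* [is_image sigma u v] : the concatenation sigma(u_0) sigma(u_1) ... is an
   infinite word, equal to v.  The second clause is needed because a morphism
   may erase letters, in which case the concatenation could be finite. *)
Definition is_image (A B : Type) (sigma : seq A -> seq B)
    (u : infword A) (v : infword B) : Prop :=
  (forall n : nat, appears_at (sigma (block u 0 n)) v 0) /\
  (forall N : nat, exists n : nat, N <= size (sigma (block u 0 n))).

Lemma is_image_unique (A B : Type) (sigma : seq A -> seq B)
    (u : infword A) (v v' : infword B) :
  is_image sigma u v -> is_image sigma u v' -> v =1 v'.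
Proof.
move=> [hv hN] [hv' _] j; have [n hn] := hN j.+1.
have := hv' n; rewrite /appears_at {1}hv.
move/(congr1 (fun s => nth (v j) s j)).
by rewrite !(nth_map 0) ?size_iota // nth_iota // add0n.
Qed.

(* By [is_image_unique] the word v below is sigma(u) itself; requiring it to
   exist makes the infiniteness of sigma(u) part of the property. *)
Definition strongly_modulo_recurrent (A : finType) (u : infword A) : Prop :=
  forall sigma : seq A -> seq A, word_morphism sigma ->
  (forall a b : A, a != b ->
     gcdn (size (sigma [:: a])) (size (sigma [:: b])) = 1) ->
  exists2 v : infword A, is_image sigma u v & modulo_recurrent v.

(* Main.v *)
Require Import Defs.
From mathcomp Require Import all_boot all_algebra.
From mathcomp Require Import boolp zify.

(* Fix a modulus k and let S(n) in Z/k be the length of sigma(u_0 ... u_(n-1)).  It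
   suffices that at the occurrences of any factor w of u, S takes every value.  Let
   E(w) be the set of these values, and choose w with E(w) of least cardinality.  If w
   occurs at i <= j, the factor of u spanning both occurrences has, by minimality, as
   many values as w, so S(j) - S(i) stabilizes E(w).  Let H be the stabilizer of E(w).
   Since u is uniformly recurrent, S(n) mod H is determined by a long enough block of
   u at n; as u has exactly one right special factor of each length, the length of
   this block can be decreased down to 0.  Hence S is constant mod H, so H contains
   |sigma(a)| and |sigma(b)|, which are coprime: H, and therefore every E, is Z/k.

   Uniform recurrence: as u is not eventually periodic, two occurrences of a factor
   cannot be followed by the same infinite word, so every factor is a prefix of a
   right special one, and the latter has bounded gaps because all other blocks of its
   length determine the next letter. *)

Set Implicit Arguments.
Unset Strict Implicit.
Unset Printing Implicit Defensive.

(** * Equality of blocks at two positions *)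

Section Blocks.
Variable A : Type.
Implicit Types (u : infword A) (w : seq A).

Lemma size_block u i n : size (block u i n) = n.
Proof. by rewrite size_map size_iota. Qed.

Lemma block_eqP u v i j n :
  block u i n = block v j n <-> (forall t, t < n -> u (i + t) = v (j + t)).
Proof.
split=> [e t tn | e].
  have := congr1 (fun s => nth (u 0) s t) e.
  by rewrite !(nth_map 0) ?size_iota // !nth_iota.
apply: (@eq_from_nth _ (u 0)); first by rewrite !size_block.
move=> t; rewrite size_block => tn.
by rewrite !(nth_map 0) ?size_iota // !nth_iota // e.
Qed.

Lemma block_cat u i m n : block u i (m + n) = block u i m ++ block u (i + m) n.
Proof. by rewrite /block iotaD map_cat. Qed.

Lemma block_eqS u i j n :
  block u i n = block u j n -> u (i + n) = u (j + n) ->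
  block u i n.+1 = block u j n.+1.
Proof. by move=> e e'; rewrite -addn1 !block_cat e /block /= e'. Qed.

Lemma block_eq_shift u i j n :
  block u i n = block u j n -> u (i + n) = u (j + n) ->
  block u i.+1 n = block u j.+1 n.
Proof.
move=> /block_eqS e /e /block_eqP h; apply/block_eqP => t tn.
by rewrite !addSnnS h.
Qed.

Lemma appears_block u i n : appears_at (block u i n) u i.
Proof. by rewrite /appears_at size_block. Qed.

Lemma block_eq_sub u i j n m t :
  block u i n = block u j n -> t + m <= n -> block u (i + t) m = block u (j + t) m.
Proof.
move=> /block_eqP e tm; apply/block_eqP => s sm.
by rewrite -!addnA e //; lia.
Qed.

Lemma appears_rcons u w i :
  appears_at w u i -> appears_at (rcons w (u (i + size w))) u i.
Proof.
move=> h; rewrite /appears_at size_rcons -addn1 block_cat -h.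
by rewrite /block /= cats1.
Qed.

End Blocks.

(** * Complexity, right special words and eventual periodicity *)

Section Words.
Variable A : finType.
Implicit Types (u : infword A) (w : seq A).

Definition block_tuple u i n : n.-tuple A := Tuple (introT eqP (size_block u i n)).

Definition right_special u w : Prop :=
  exists i j, [/\ appears_at w u i, appears_at w u j &
                  u (i + size w) != u (j + size w)].

Lemma right_specialI u i j n : block u i n = block u j n ->
  u (i + n) != u (j + n) -> right_special u (block u i n).
Proof.
move=> e ne; exists i, j; split; rewrite ?size_block //; first exact: appears_block.
by rewrite e; exact: appears_block.
Qed.

(** Each factor of length [n] extends by one letter to a factor, a right special one in two ways,
    and extensions of different words differ. *)
Lemma complexity_right_special u n :
  complexity u n + #|[set w : n.-tuple A | `[< right_special u w >]]|
    <= complexity u n.+1.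
Proof.
have /choice [e eP] : forall w : n.-tuple A, exists p : A * A,
    (factor u w -> factor u (rcons w p.1)) /\
    (right_special u w -> factor u (rcons w p.2) /\ p.1 <> p.2).
  move=> w; have [[i [j [wi wj ne]]]|nrs] := pselect (right_special u w).
    exists (u (i + size w), u (j + size w)); split=> _ /=.
      by exists i; apply: appears_rcons.
    by split; [exists j; apply: appears_rcons | apply/eqP].
  have [[i wi]|nf] := pselect (factor u w); last by exists (u 0, u 0).
  exists (u (i + size w), u (i + size w)); split=> // _.
  by exists i; apply: appears_rcons.
set F := [set w : n.-tuple A | `[< factor u w >]].
rewrite /complexity -/F; set RS := [set w : n.-tuple A | _].
pose g b (w : n.-tuple A) := [tuple of rcons w (if b then (e w).1 else (e w).2)].
have g_inj b : injective (g b).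
  by move=> w w' /(congr1 val) /= /rcons_inj [] /val_inj.
rewrite -(card_imset _ (g_inj true)) -(card_imset RS (g_inj false)).
have /eqP dis : g true @: F :&: g false @: RS == set0.
  apply/set0Pn => -[x /setIP [/imsetP [w _ ->] /imsetP [w' w'R]]].
  move=> /(congr1 val) /= /rcons_inj [/val_inj ww' exx]; subst w'.
  by move: w'R; rewrite inE => /asboolP /(eP w).2 [].
have -> : #|g true @: F| + #|g false @: RS| = #|g true @: F :|: g false @: RS|.
  by rewrite cardsU dis cards0 subn0.
apply: subset_leq_card; apply/subsetP => x /setUP [] /imsetP [w wF ->]; rewrite inE;
  apply/asboolP; move: wF; rewrite inE => /asboolP wF.
  exact: (eP w).1.
by have [] := (eP w).2 wF.
Qed.

Lemma block_pigeonhole u c n :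
  exists i q, [/\ c <= i, 0 < q, i + q <= c + #|{: n.-tuple A}| &
                  block u i n = block u (i + q) n].
Proof.
set K := #|_|.
pose g (t : 'I_K.+1) := block_tuple u (c + t) n.
have ninj : ~ injective g.
  by move=> /leq_card; rewrite card_ord ltnn.
have [s [t [st gst]]] : exists s t : 'I_K.+1, s < t /\ g s = g t.
  apply: contrapT => nex; apply: ninj => s t gst; apply: contrapT => nst.
  have /orP [lt|lt] : (s < t) || (t < s) by rewrite -neq_ltn; apply/eqP => /val_inj.
    by apply: nex; exists s, t.
  by apply: nex; exists t, s.
exists (c + s), (t - s); have tK := ltn_ord t; split; try lia.
move/(congr1 val): gst => /= ->.
by congr block; lia.
Qed.

(** The window of length [n] regains its initial content after [q] steps, and each content met in
    between forces the next letter, so the cycle repeats for ever. Determinism is asked only of the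
    windows of one period, since the bounded gap argument controls no others. *)
Lemma deterministic_periodic u n i q : 0 < q ->
  block u i n = block u (i + q) n ->
  (forall s t, i <= s < i + q -> i <= t -> block u s n = block u t n -> u (s + n) = u (t + n)) ->
  forall t, i + n <= t -> u t = u (t + q).
Proof.
move=> q0 e0 det.
have H t : exists s, [/\ i <= s < i + q, block u s n = block u (i + t) n &
                         block u (i + t) n = block u (i + t + q) n].
  elim: t => [|t [s [si e1 e2]]].
    by exists i; rewrite addn0; split=> //; lia.
  have d1 : u (s + n) = u (i + t + n) by apply: det => //; lia.
  have d2 : u (s + n) = u (i + t + q + n) by apply: det (etrans e1 e2) => //; lia.
  have e3 := block_eq_shift e2 (etrans (esym d1) d2).
  have e4 := block_eq_shift e1 d1.
  have [sq|sq] := ltnP s.+1 (i + q).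
    by exists s.+1; rewrite !addnS; split=> //; lia.
  exists i; rewrite addnS; split=> //; first lia.
  by rewrite -e4 e0; congr block; lia.
move=> t it; have [s [si e1 e2]] := H (t - n - i).
have d1 := det _ _ si _ e1; have d2 := det _ _ si _ (etrans e1 e2).
rewrite (_ : t = i + (t - n - i) + n); last lia.
by rewrite -d1 ?d2; [congr u| |]; lia.
Qed.

(** Every factor starts somewhere below [c + q], as a later start can be lowered by a multiple of
    [q]. *)
Lemma complexity_periodic u c q n : 0 < q ->
  (forall t, c <= t -> u t = u (t + q)) -> complexity u n <= c + q.
Proof.
move=> q0 per.
have perm t m : c <= t -> u t = u (t + m * q).
  elim: m => [|m IH] ct; first by rewrite addn0.
  have := per (t + m * q); rewrite -IH // => h.
  by rewrite h; [congr u|]; lia.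
pose g (t : 'I_(c + q)) := block_tuple u t n.
rewrite -[leqRHS]card_ord -cardsT.
apply: leq_trans (leq_imset_card g _).
apply: subset_leq_card; apply/subsetP => w; rewrite inE => /asboolP [i wi].
pose i' := if i < c + q then i else c + (i - c) %% q.
have lti' : i' < c + q.
  by rewrite /i'; case: ifP => // _; rewrite ltn_add2l ltn_pmod.
apply/imsetP; exists (Ordinal lti') => //; apply/val_inj; rewrite /= {1}wi size_tuple.
apply/block_eqP => j jn; rewrite /i'; case: ifP => // h.
rewrite [RHS](perm _ ((i - c) %/ q)); last lia.
by congr u; have := divn_eq (i - c) q; lia.
Qed.

(** * Recurrence in Sturmian words *)

Section Sturmian.
Variable u : infword A.
Hypothesis uS : sturmian u.

Lemma sturmian_not_periodic c q :
  0 < q -> ~ (forall t, c <= t -> u t = u (t + q)).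
Proof.
by move=> q0 /(complexity_periodic (c + q) q0); rewrite uS ltnn.
Qed.

(** The complexity grows by exactly one, which leaves room for one right special word of each
    length. *)
Lemma right_special_unique w w' : size w = size w' ->
  right_special u w -> right_special u w' -> w = w'.
Proof.
move=> ss rw rw'; apply: contrapT => ne.
have := complexity_right_special u (size w).
rewrite !uS -[leqRHS]addn1 leq_add2l => /card_le1_eqP h.
have w'size : size w' == size w by rewrite ss.
have {}h : in_tuple w = Tuple w'size.
  by apply: h; rewrite inE; apply/asboolP.
exact/ne/(congr1 val h).
Qed.

Lemma sturmian_right_special_from c n :
  exists i j, [/\ c <= i, c <= j, block u i n = block u j n & u (i + n) != u (j + n)].
Proof.
apply: contrapT => nex.
have [i [q [ci q0 _ e]]] := block_pigeonhole u c n.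
apply: (@sturmian_not_periodic (i + n) q) => //.
apply: deterministic_periodic => // s t si it est; apply: contrapT => /eqP ne.
by apply: nex; exists s, t; split=> //; lia.
Qed.

(** The tail of [u] from [c] has a right special word of every length, hence at least [n + 1]
    factors of length [n]; all are factors of [u], which has no more. *)
Lemma sturmian_recurrent w c : factor u w -> exists2 i, c <= i & appears_at w u i.
Proof.
pose u' := fun t => u (c + t).
have blk i n : block u' i n = block u (c + i) n.
  by apply/block_eqP => t _; rewrite /u' addnA.
have le n : n.+1 <= complexity u' n.
  elim: n => [|n IH].
    rewrite /complexity card_gt0; apply/set0Pn; exists [tuple]; rewrite inE.
    by apply/asboolP; exists 0.
  apply: leq_trans (complexity_right_special u' n).
  rewrite -addn1; apply: leq_add IH _.
  have [i [j [ci cj e ne]]] := sturmian_right_special_from c n.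
  have size_b : size (block u i n) == n by rewrite size_block.
  rewrite card_gt0; apply/set0Pn; exists (Tuple size_b); rewrite inE.
  apply/asboolP; exists (i - c), (j - c).
  by rewrite /appears_at /u' /= !size_block !blk !addnA !subnKC // -e.
pose F v := [set w0 : (size w).-tuple A | `[< factor v w0 >]].
move=> wf; have : in_tuple w \in F u by rewrite inE; apply/asboolP.
have /eqP <- : F u' == F u.
  rewrite eqEcard; apply/andP; split; last first.
    by apply: leq_trans (le (size w)); rewrite -(uS (size w)).
  apply/subsetP => x; rewrite !inE => /asboolP [i xi]; apply/asboolP.
  by exists (c + i); rewrite /appears_at -blk.
rewrite inE => /asboolP [i wi]; exists (c + i); first exact: leq_addr.
by rewrite /appears_at -blk.
Qed.

Lemma factor_prefix_right_special w : factor u w ->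
  exists2 w', right_special u w' & prefix w w'.
Proof.
move=> wf; have [i wi] := wf.
have [j ij wj] := sturmian_recurrent i.+1 wf.
have ebij : block u i (size w) = block u j (size w) by rewrite -wi -wj.
have [t ne] : exists t, u (i + t) != u (j + t).
  apply: contrapT => nex; apply: (@sturmian_not_periodic i (j - i)); first lia.
  move=> t it; apply: contrapT => /eqP ne; apply: nex; exists (t - i).
  by rewrite subnKC // (_ : j + (t - i) = t + (j - i)) //; lia.
(* The first disagreement comes after [w], so the block that ends just before it extends [w] and is
   right special. *)
have [m nem minm] := ex_minnP (ex_intro (fun t => u (i + t) != u (j + t)) t ne).
have em : block u i m = block u j m.
  apply/block_eqP => s sm; apply/eqP/contraT => /minm; lia.
have wm : size w <= m.
  rewrite leqNgt; apply/negP => mw; move/block_eqP/(_ m mw)/eqP: ebij.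
  exact/negP.
exists (block u i m); first exact: right_specialI em nem.
by rewrite -(subnKC wm) block_cat -wi prefix_prefix.
Qed.

Lemma sturmian_uniformly_recurrent w : factor u w ->
  exists K, forall c, exists t, [/\ c <= t, t <= c + K & appears_at w u t].
Proof.
move=> /factor_prefix_right_special [r rs /prefixP [w' rE]].
exists #|{: (size r).-tuple A}| => c.
suff [t [ct tc rt]] : exists t,
    [/\ c <= t, t <= c + #|{: (size r).-tuple A}| & appears_at r u t].
  exists t; split=> //; move: rt; rewrite /appears_at rE size_cat block_cat.
  by move/(congr1 (take (size w))); rewrite !take_size_cat ?size_block.
(* If [r] started nowhere in this range, no block starting there would be right special, and a
   repetition within the range would make [u] eventually periodic. *)
apply: contrapT => nex.
have [i [q [ci q0 qc e]]] := block_pigeonhole u c (size r).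
apply: (@sturmian_not_periodic (i + size r) q) => //.
apply: deterministic_periodic => // s t si _ est; apply: contrapT => /eqP ne.
apply: nex; exists s; split; try lia.
apply: right_special_unique rs (right_specialI est ne).
by rewrite size_block.
Qed.

Lemma sturmian_letter (a : A) : #|A| = 2 -> exists i, u i = a.
Proof.
move=> A2.
have : [tuple a] \in [set w : 1.-tuple A | `[< factor u w >]].
  rewrite (_ : [set w | _] = setT) ?inE //.
  apply/eqP; rewrite eqEcard subsetT cardsT card_tuple A2 expn1.
  by rewrite -[leqLHS](uS 1) leqnn.
by rewrite inE => /asboolP [i [->]]; exists i.
Qed.

(** * Prefix weights in a finite abelian group *)

Section Weights.
Import GRing.Theory.
Local Open Scope ring_scope.
Variables (G : finZmodType) (f : A -> G).

(** This is S(n) of the outline once [f a] is |sigma(a)| modulo k. *)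
Definition weight (n : nat) : G := \sum_(0 <= j < n) f (u j).

Lemma weightS n : weight n.+1 = weight n + f (u n).
Proof. by rewrite /weight big_nat_recr. Qed.

Lemma weight_shift n t : weight (n + t) - weight n = \sum_(0 <= j < t) f (u (n + j)%N).
Proof.
elim: t => [|t IH]; first by rewrite addn0 subrr big_geq.
by rewrite addnS weightS addrAC IH big_nat_recr.
Qed.

Lemma weight_block_eq i j n t : block u i n = block u j n -> (t <= n)%N ->
  weight (i + t) - weight i = weight (j + t) - weight j.
Proof.
move=> /block_eqP e tn; rewrite !weight_shift; apply: eq_big_nat => s /andP [_ st].
by rewrite e // (leq_trans st).
Qed.

Section Descent.
Variable H : {pred G}.
Hypotheses (H0 : 0 \in H) (HB : forall x y, x \in H -> y \in H -> x - y \in H).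

Let Hsym x y : x - y \in H -> y - x \in H.
Proof. by move=> h; rewrite -opprB -sub0r HB. Qed.

Let Htrans y x z : x - y \in H -> y - z \in H -> x - z \in H.
Proof.
move=> hxy /Hsym hyz.
have -> : x - z = (x - y) - (z - y) by rewrite opprB addrA subrK.
exact: HB.
Qed.

Hypothesis A2 : #|A| = 2%N.

(* If [yv] is the right special word of length [n.+1], then [v] is the right special
   word of length [n]; each of the two words [va], [vb] follows an occurrence of [yv],
   and the weight after [yv] does not depend on the letter that comes next. *)
Lemma weight_descent n :
  (forall i j, block u i n.+1 = block u j n.+1 -> weight j - weight i \in H) ->
  forall i j, block u i n = block u j n -> weight j - weight i \in H.
Proof.
move=> HS i j eij.
have [eq_next|ne] := eqVneq (u (i + n)%N) (u (j + n)%N); first exact/HS/block_eqS.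
have [s [t [_ _ est nest]]] := sturmian_right_special_from 0 n.+1.
have ust : u s = u t by move/block_eqP: est => /(_ 0 isT); rewrite !addn0.
have est' : block u s.+1 n = block u t.+1 n.
  by have := block_eq_sub (t := 1) (m := n) est; rewrite !addn1; apply; lia.
have nest' : u (s.+1 + n)%N != u (t.+1 + n)%N by rewrite !addSnnS.
have eis : block u i n = block u s.+1 n.
  apply: right_special_unique (right_specialI eij ne) (right_specialI est' nest').
  by rewrite !size_block.
have Hst : weight t.+1 - weight s.+1 \in H.
  by rewrite !weightS ust opprD addrACA subrr addr0 HS.
have two (a b c d : A) : a != b -> c != d -> a = c /\ b = d \/ a = d /\ b = c.
  move=> ab cd.
  have full : [set a; b] = [set: A].
    by apply/eqP; rewrite eqEcard subsetT cardsT A2 cards2 ab.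
  have := in_setT c; have := in_setT d; rewrite -full !inE.
  move=> /orP [] /eqP dE /orP [] /eqP cE; subst; auto; by rewrite eqxx in cd.
(* The letters that follow at [i] and [j] are those at [s.+1] and [t.+1], in the same or in the
   opposite order. *)
have [[e1 e2]|[e1 e2]] := two _ _ _ _ ne nest'.
  have h1 := HS _ _ (block_eqS eis e1).
  have h2 := HS _ _ (block_eqS (etrans (etrans (esym eij) eis) est') e2).
  exact: Htrans (Hsym h2) (Htrans Hst h1).
have h1 := HS _ _ (block_eqS (etrans eis est') e1).
have h2 := HS _ _ (block_eqS (etrans (esym eij) eis) e2).
exact: Htrans (Hsym h2) (Htrans (Hsym Hst) h1).
Qed.

(** At length 0 all blocks agree, so consecutive weights, which differ by [f (u i)], agree modulo
    [H]; and every letter occurs in [u]. *)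
Lemma weight_descent0 n :
  (forall i j, block u i n = block u j n -> weight j - weight i \in H) ->
  forall a, f a \in H.
Proof.
elim: n => [h a|n IH /weight_descent /IH //].
have [i ai] := sturmian_letter a A2.
by rewrite -ai -[f _](addKr (weight i)) -weightS addrC h.
Qed.
End Descent.

(** The set E(w) of the outline. *)
Definition residues w : {set G} :=
  [set x | `[< exists2 i, appears_at w u i & weight i = x >]].

Lemma residuesP w x : reflect (exists2 i, appears_at w u i & weight i = x) (x \in residues w).
Proof. by rewrite inE; apply: asboolP. Qed.

Definition stabilizer (E : {set G}) : {pred G} := [pred x | [set y + x | y in E] == E].

Lemma card_translate (E : {set G}) x : #|[set y + x | y in E]| = #|E|.
Proof. exact/card_imset/addIr. Qed.

(** Translation is injective and [E] finite, so inclusion suffices. *)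
Lemma stabilizerI (E : {set G}) x : (forall y, y \in E -> y + x \in E) -> x \in stabilizer E.
Proof.
move=> h; rewrite inE eqEcard card_translate leqnn andbT.
by apply/subsetP => _ /imsetP [y yE ->]; apply: h.
Qed.

Lemma stabilizerD (E : {set G}) x y : x \in stabilizer E -> y \in E -> y + x \in E.
Proof. by rewrite inE => /eqP h /(imset_f (+%R^~ x)); rewrite /= h. Qed.

Lemma stabilizerBr (E : {set G}) x y : x \in stabilizer E -> y \in E -> y - x \in E.
Proof.
rewrite inE => /eqP h yE.
by move: yE; rewrite -{1}h => /imsetP [z zE ->]; rewrite addrK.
Qed.

Lemma stabilizer0 (E : {set G}) : 0 \in stabilizer E.
Proof. by apply: stabilizerI => y; rewrite addr0. Qed.

Lemma stabilizerB (E : {set G}) x y :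
  x \in stabilizer E -> y \in stabilizer E -> x - y \in stabilizer E.
Proof.
move=> hx hy; apply: stabilizerI => z zE.
by rewrite addrA; apply: stabilizerBr hy _; apply: stabilizerD.
Qed.

Lemma minimal_residues_stabilizer w : factor u w ->
  (forall w', factor u w' -> #|residues w| <= #|residues w'|)%N ->
  forall i j, appears_at w u i -> appears_at w u j ->
  weight j - weight i \in stabilizer (residues w).
Proof.
move=> wf wmin i j wi wj; wlog ij : i j wi wj / (i <= j)%N.
  move=> h; have [/h|/ltnW /h ] := leqP i j; first exact.
  by move=> /(_ wj wi) hh; rewrite -opprB -sub0r stabilizerB ?stabilizer0.
pose w' := block u i (j - i + size w)%N.
(* Each occurrence of the spanning factor carries two occurrences of [w], whose weights always
   differ by the same amount. *)
have w'at s : appears_at w' u s -> appears_at w u s /\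
    appears_at w u (s + (j - i)) /\ weight (s + (j - i))%N = weight s + (weight j - weight i).
  rewrite /appears_at {2}/w' size_block => e; split.
    rewrite {1}wi; have := block_eq_sub (t := 0) (m := size w) e; rewrite !addn0.
    by apply; rewrite leq_addl.
  split.
    rewrite {1}wj; have := block_eq_sub (t := (j - i)%N) (m := size w) e.
    by rewrite subnKC //; apply.
  have := weight_block_eq e (leq_addr _ _); rewrite subnKC // => ->.
  by rewrite addrC subrK.
have eqr : residues w' = residues w.
  apply/eqP; rewrite eqEcard wmin; last by exists i; apply: appears_block.
  rewrite andbT; apply/subsetP => x /residuesP [s /w'at [ws _] <-].
  by apply/residuesP; exists s.
apply: stabilizerI => x; rewrite -{1}eqr => /residuesP [s /w'at [_ [wsj e]] <-].
by apply/residuesP; exists (s + (j - i))%N.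
Qed.

(** The hypothesis on [H] says that the values of [f] generate [G]. *)
Lemma sturmian_residues_full : #|A| = 2%N ->
  (forall H : {pred G}, 0 \in H -> (forall x y, x \in H -> y \in H -> x - y \in H) ->
     (forall a, f a \in H) -> forall x, x \in H) ->
  forall w, factor u w -> forall x, exists2 i, appears_at w u i & weight i = x.
Proof.
move=> A2 gen w0 w0f x; apply/residuesP.
pose P n := `[< exists2 w, factor u w & #|residues w| = n >].
have [c /asboolP [w wf wc] cmin] : exists2 c, P c & forall n, P n -> (c <= n)%N.
  have ex : exists n, P n by exists #|residues w0|; apply/asboolP; exists w0.
  by have [c ? ?] := ex_minnP ex; exists c.
have wmin w' : factor u w' -> (#|residues w| <= #|residues w'|)%N.
  by move=> w'f; rewrite wc; apply: cmin; apply/asboolP; exists w'.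
have stab := minimal_residues_stabilizer wf wmin.
have [K hK] := sturmian_uniformly_recurrent wf.
have full y : y \in stabilizer (residues w).
  apply: (gen _ (stabilizer0 _) (@stabilizerB _)).
  apply: (weight_descent0 (stabilizer0 _) (@stabilizerB _) A2 (n := (K + size w)%N)).
  (* A block of length [K + size w] contains [w]; equal blocks at [i] and [j] contain it at the same
     offset, so comparing weights there compares them at [i] and [j]. *)
  move=> i j e; have [t [it tK wt]] := hK i.
  have te : (t = i + (t - i))%N by rewrite subnKC.
  have wt' : appears_at w u (j + (t - i)).
    have := block_eq_sub (t := (t - i)%N) (m := size w) e; rewrite -te -wt.
    by apply; rewrite leq_add2r leq_subLR.
  have h : weight t - weight i = weight (j + (t - i)) - weight j.
    by rewrite {1}te; apply: weight_block_eq e _; lia.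
  suff -> : weight j - weight i = weight (j + (t - i)) - weight t by apply: stab.
  rewrite -[weight (j + _)](subrK (weight j)) -h addrAC.
  by rewrite [weight t - _ - _]addrAC subrr add0r addrC.
have wT : residues w = setT.
  apply/setP => y; rewrite in_setT; have [i wi] := wf.
  rewrite -[y](subrK (weight i)) addrC; apply: stabilizerD (full _) _.
  by apply/residuesP; exists i.
(* Since [w] is minimal, no factor has fewer residues than the whole group. *)
have : residues w0 = setT by apply/eqP; rewrite eqEcard subsetT /= -wT wmin.
by move->.
Qed.
End Weights.
End Sturmian.
End Words.

(** * Image lengths and modulo-recurrence of the image word *)

Lemma morphism_cat_prefix (A B : Type) (sigma : seq A -> seq B) (u : infword A) m n :
  word_morphism sigma -> m <= n ->
  sigma (block u 0 n) = sigma (block u 0 m) ++ sigma (block u m (n - m)).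
Proof.
move=> [_ sD] mn; rewrite -sD -(block_cat u 0 m (n - m)).
by rewrite subnKC.
Qed.

Section Morphism.
Variables (A : finType) (sigma : seq A -> seq A) (u : infword A).
Hypotheses (A2 : #|A| = 2) (uS : sturmian u) (sM : word_morphism sigma).
Hypothesis sigma_coprime :
  forall a b : A, a != b -> gcdn (size (sigma [:: a])) (size (sigma [:: b])) = 1.

Let len n := size (sigma (block u 0 n)).

Lemma image_length_mod w k r : factor u w -> 0 < k ->
  exists2 s, appears_at w u s & len s = r %[mod k].
Proof.
(* The modulus becomes [k.+1], so that ['I_k.+1] is a group of residues. *)
case: k => // k wf _.
pose f (a : A) : 'I_k.+1 := inZp (size (sigma [:: a])).
have inZpD m n : inZp (m + n) = (inZp m + inZp n)%R :> 'I_k.+1.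
  by apply/val_inj; rewrite /= modnDm.
have weightE n : weight u f n = inZp (len n).
  elim: n => [|n IH].
    by rewrite /weight big_geq // /len sM.1; apply/val_inj; rewrite /= mod0n.
  by rewrite weightS IH -inZpD /len (morphism_cat_prefix _ sM (leqnSn n)) size_cat subSnn.
have gen (H : {pred 'I_k.+1}) : (0 \in H)%R ->
    (forall x y, x \in H -> y \in H -> (x - y)%R \in H) ->
    (forall a, f a \in H) -> forall x, x \in H.
  move=> H0 HB Hf.
  have HD x y : x \in H -> y \in H -> (x + y)%R \in H.
    by move=> hx hy; rewrite -[y]GRing.opprK HB // -GRing.sub0r HB.
  have HM c m : inZp m \in H -> inZp (c * m) \in H.
    move=> hm; elim: c => [|c IH]; last by rewrite mulSn inZpD HD.
    by rewrite (_ : inZp _ = 0%R) //; apply/val_inj; rewrite /= mod0n.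
  have [a [b ab]] : exists a b : A, a != b.
    have /card_gt1P [a [b [_ _ ab]]] : 1 < #|A| by rewrite A2.
    by exists a, b.
  have H1 : inZp 1 \in H.
    have := sigma_coprime ab; have [->|a0] := posnP (size (sigma [:: a])).
      by rewrite gcd0n => <-; apply: Hf.
    (* By the Bezout identity, 1 is a difference of multiples of the two lengths. *)
    move=> cop; case: (egcdnP (size (sigma [:: b])) a0) => c d e _.
    have := HM c _ (Hf a); rewrite e cop inZpD => h.
    rewrite -[inZp 1](GRing.addKr (inZp (d * size (sigma [:: b])))) GRing.addrC.
    by apply: HB => //; apply/HM/(Hf b).
  by move=> x; rewrite -[x]valZpK -[val x]muln1 HM.
have [s ws] := sturmian_residues_full uS A2 gen wf (inZp r).
rewrite weightE => /(congr1 val) /= e; by exists s.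
Qed.

(** Coprimality prevents both letters from being erased, and a letter with nonempty image recurs for
    ever. *)
Lemma image_length_unbounded N : exists n, N <= len n.
Proof.
elim: N => [|N [n Nn]]; first by exists 0.
have [a a0] : exists a, 0 < size (sigma [:: a]).
  have /card_gt1P [a [b [_ _ ab]]] : 1 < #|A| by rewrite A2.
  have := sigma_coprime ab; have [->|a0 _] := posnP (size (sigma [:: a])).
    by rewrite gcd0n => b1; exists b; rewrite b1.
  by exists a.
have [i ui] := sturmian_letter uS a A2.
have [|j nj uj] := @sturmian_recurrent _ _ uS [:: a] n.
  by exists i; rewrite /appears_at /block /= ui.
exists j.+1; rewrite /len (morphism_cat_prefix _ sM (leqnSn j)) size_cat subSnn -uj.
have : len n <= len j by rewrite /len (morphism_cat_prefix _ sM nj) size_cat leq_addr.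
by rewrite /len in Nn *; lia.
Qed.

Lemma image_exists : exists v, is_image sigma u v.
Proof.
have /choice [N NP] : forall j, exists n, j < len n.
  by move=> j; apply: image_length_unbounded.
(* The choice of [N j] is immaterial, since images of prefixes are prefixes of one another; the
   default [u 0] is never reached. *)
exists (fun j => nth (u 0) (sigma (block u 0 (N j))) j); split.
  move=> n; apply: (@eq_from_nth _ (u 0)); first by rewrite size_block.
  move=> j jn; rewrite (nth_map 0) ?size_iota // nth_iota // add0n.
  have [le|/ltnW le] := leqP n (N j); rewrite (morphism_cat_prefix _ sM le) nth_cat.
    by rewrite jn.
  by rewrite (NP j).
exact: image_length_unbounded.
Qed.

Lemma image_modulo_recurrent v : is_image sigma u v -> modulo_recurrent v.
Proof.
move=> [vP _] w [m wm] k k0 i ik.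
(* The image of this prefix of [u] covers the given occurrence of [w], so each recurrence of the
   prefix yields a new one, again at offset [m]. *)
have [n mn] := image_length_unbounded (m + size w).
have w0f : factor u (block u 0 n) by exists 0; apply: appears_block.
(* As [m <= k * m], the target is a natural number congruent to i - m modulo [k]; adding the offset
   [m] gives residue [i]. *)
have [s ws es] := image_length_mod (i + (k * m - m)) w0f k0.
have e0 : block u s n = block u 0 n by rewrite ws size_block.
have vE t : sigma (block u 0 t) = block v 0 (len t) := vP t.
have blk : block v (len s) (len n) = block v 0 (len n).
  have sigmaD : sigma (block u 0 (s + n)) = sigma (block u 0 s) ++ sigma (block u 0 n).
    by rewrite (morphism_cat_prefix _ sM (leq_addr n s)) addKn e0.
  have := sigmaD; rewrite !vE {1}/len sigmaD size_cat block_cat add0n.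
  by move/eqP; rewrite eqseq_cat ?size_block // => /andP [_ /eqP].
have wsm : appears_at w v (len s + m).
  have := block_eq_sub blk mn; rewrite add0n /appears_at => ->; exact: wm.
exists ((len s + m) %/ k).
rewrite mulnC; suff <- : (len s + m) %% k = i by rewrite -divn_eq.
rewrite -modnDml es modnDml -addnA subnK ?leq_pmull //.
by rewrite mulnC addnC modnMDl modn_small.
Qed.
End Morphism.

Theorem theorem5p1 (A : finType) (hA : #|A| = 2) (u : infword A) :
  sturmian u -> strongly_modulo_recurrent u.
Proof.
move=> uS sigma sM cop; have [v vP] := image_exists hA uS sM cop.
by exists v => //; apply: image_modulo_recurrent vP.
Qed.
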